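(* Consider the following procedure on a deterministic labeled graph $G$: set $X\gets Q_G$ and $u\gets\epsilon$; while $|X|\ge 2$, choose distinct $p,q\in X$ and look for a word $w$ that is pair-synchronizing for $p$ and $q$; if such $w$ exists, set $X\gets X\cdot w$ and $u\gets uw$, otherwise return nil; when the loop ends, return $u$. Then, given an irreducible deterministic labeled graph $G$, this procedure returns a synchronizing word for $G$ if one exists, and returns nil otherwise.
   Context: A labeled graph $G$ has a finite vertex set $Q_G$, finite edge set, initial/terminal vertex maps on edges and an edge labeling into a finite alphabet (loops and multiple edges allowed; $G$ need not be essential). Paths are finite sequences of consecutive edges, their labels the concatenated edge labels; each vertex has an empty path labeled by the empty word $\epsilon$. $F_G(q)$ is the set of labels of paths starting at $q$. $G$ is deterministic if no vertex has two outgoing edges with the same label; then $q\cdot w$ denotes the end vertex of the unique path from $q$ labeled $w$ (defined iff $w\in F_G(q)$), and for $S\subseteq Q_G$, $S\cdot w=\{q\cdot w:q\in S,\ w\in F_G(q)\}$. $G$ is irreducible if for all vertices $p,q$ there is a path from $p$ to $q$. A word $w$ is synchronizing for $G$ if $|Q_G\cdot w|=1$. A word $w$ is pair-synchronizing for vertices $p,q$ if $|\{p,q\}\cdot w|=1$. *)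

(* Defs.v *)
From mathcomp Require Import all_boot.
From Stdlib Require Import Relations.

Set Implicit Arguments.
Unset Strict Implicit.
Unset Printing Implicit Defensive.

Record labeled_graph (A : finType) := LabeledGraph {
  vertex : finType;
  edge : finType;
  init : edge -> vertex;
  term : edge -> vertex;
  label : edge -> A
}.

Section LabeledGraph.

Variables (A : finType) (G : labeled_graph A).
Implicit Types (p q t : vertex G) (e f : edge G) (es : seq (edge G)).
Implicit Types (w u : seq A) (S X : {set vertex G}).

(* The starting vertex is explicit, so that every vertex has its own empty
   path. *)
Fixpoint path_from q es : bool :=
  if es is e :: es' then (init e == q) && path_from (term e) es' else true.

Definition path_end q es : vertex G := last q [seq term e | e <- es].

Definition path_label es : seq A := [seq label e | e <- es].

Definition follower q w : Prop :=
  exists2 es, path_from q es & path_label es = w.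

Definition deterministic : Prop :=
  forall e f, init e = init f -> label e = label f -> e = f.

Definition irreducible : Prop :=
  forall p q, exists2 es, path_from p es & path_end p es = q.

(* [act q w] is q . w, with [None] for "undefined".  A path labeled w has
   exactly [size w] edges; when G is deterministic there is at most one such
   path from q, so that the pick is not a choice (see [actP]). *)
Definition act q w : option (vertex G) :=
  omap (fun es : (size w).-tuple (edge G) => path_end q es)
    [pick es : (size w).-tuple (edge G) |
       path_from q es && (path_label es == w)].

Definition set_act S w : {set vertex G} :=
  [set t | [exists q in S, act q w == Some t]].

Definition synchronizing w : Prop := #|set_act [set: vertex G] w| = 1.

Definition pair_synchronizing p q w : Prop := #|set_act [set p; q] w| = 1.

(* The procedure makes free choices (of p, q and w), so it is a transition
   relation: [Running X u] is the state at the loop test, and [Returned None]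
   is the outcome "nil".  Once p and q are chosen, nil is returned only if no
   word is pair-synchronizing for that pair. *)
Variant state :=
  | Running of {set vertex G} & seq A
  | Returned of option (seq A).

Variant step : state -> state -> Prop :=
  | StepMerge X u p q w of
      2 <= #|X| & p \in X & q \in X & p != q & pair_synchronizing p q w :
      step (Running X u) (Running (set_act X w) (u ++ w))
  | StepFail X u p q of
      2 <= #|X| & p \in X & q \in X & p != q
      & (forall w, ~ pair_synchronizing p q w) :
      step (Running X u) (Returned None)
  | StepExit X u of ~~ (2 <= #|X|) :
      step (Running X u) (Returned (Some u)).

Definition start : state := Running [set: vertex G] [::].

Definition reachable (s : state) : Prop := clos_refl_trans _ step start s.

Definition terminates : Prop := Acc (fun s' s => step s s') start.

Definition never_stuck : Prop :=
  forall s, reachable s ->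
    (exists r, s = Returned r) \/ (exists s', step s s').

(* Whatever choices are made, the run ends and the value returned satisfies
   [P]. *)
Definition procedure_returns (P : option (seq A) -> Prop) : Prop :=
  [/\ terminates, never_stuck & forall r, reachable (Returned r) -> P r].

Lemma path_from_label_inj q es es' :
  deterministic -> path_from q es -> path_from q es' ->
  path_label es = path_label es' -> es = es'.
Proof.
move=> det; elim: es q es' => [|e es IHes] q [|f es'] //=.
move=> /andP[/eqP eq_e pes] /andP[/eqP eq_f pes'] [eq_lab eq_labs].
have eq_ef : e = f by apply: det => //; rewrite eq_e.
by rewrite -{}eq_ef in pes' *; rewrite (IHes _ _ pes pes').
Qed.

Lemma actP q w t : deterministic ->
  act q w = Some t <->
  exists es, [/\ path_from q es, path_label es = w & path_end q es = t].
Proof.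
move=> det; rewrite /act; case: pickP => [es /andP[pes /eqP les]|no_es] /=.
  split=> [[<-]|[es' [pes' les' <-]]]; first by exists es.
  by rewrite (path_from_label_inj det pes pes') // les les'.
split=> // -[es [pes les _]].
have sz_es : size es == size w by rewrite -les size_map.
by have := no_es (Tuple sz_es); rewrite /= pes les eqxx.
Qed.

Lemma act_defined q w : act q w <> None <-> follower q w.
Proof.
rewrite /act; case: pickP => [es /andP[pes /eqP les]|no_es] /=.
  by split=> // _; exists es.
split=> // -[es pes les].
have sz_es : size es == size w by rewrite -les size_map.
by have := no_es (Tuple sz_es); rewrite /= pes les eqxx.
Qed.

End LabeledGraph.

(* Main.v *)
(** A successful merge of a pair strictly shrinks [X]: either the two vertices
    get the same image, or exactly one of them loses its image.  Hence the loop
    ends, and since [X] is always the nonempty set [Q_G . u], leaving the loop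
    normally means that [u] is synchronizing.  Conversely, if [w] is
    synchronizing and defined at [q0], irreducibility gives a word [v] leading
    from [p] to [q0], and [vw] is pair-synchronizing for [p] and any [q]:
    [{p, q} . vw] contains [p . vw] and lies in [Q_G . w].  So nil is never
    returned in that case. *)

Require Import Defs.
From mathcomp Require Import all_boot.
From Stdlib Require Import Relations Classical.

Set Implicit Arguments.
Unset Strict Implicit.
Unset Printing Implicit Defensive.

Section Action.

Variables (A : finType) (G : labeled_graph A).
Implicit Types (p q t : vertex G) (w u v : seq A) (S X : {set vertex G}).

Lemma set_actP S w t :
  reflect (exists2 q, q \in S & act q w = Some t) (t \in set_act S w).
Proof.
rewrite inE; apply: (iffP existsP) => [[q /andP[Sq /eqP qwt]]|[q Sq qwt]].
  by exists q.
by exists q; rewrite Sq qwt /=.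
Qed.

Lemma set_actS S X w : S \subset X -> set_act S w \subset set_act X w.
Proof.
move=> /subsetP sSX; apply/subsetP => t /set_actP[q Sq qwt].
by apply/set_actP; exists q; first exact: sSX.
Qed.

Lemma path_from_cat q (es es' : seq (edge G)) :
  path_from q (es ++ es') = path_from q es && path_from (path_end q es) es'.
Proof. by elim: es q => //= e es IHes q; rewrite IHes andbA. Qed.

Lemma path_end_cat q (es es' : seq (edge G)) :
  path_end q (es ++ es') = path_end (path_end q es) es'.
Proof. by rewrite /path_end map_cat last_cat. Qed.

(* [p . w] and [q . w] cannot be defined and distinct, so at most one of the
   two is needed to obtain [X . w]. *)
Lemma card_set_act_pair_synchronizing X p q w :
  p \in X -> q \in X -> p != q -> pair_synchronizing p q w ->
  #|set_act X w| < #|X|.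
Proof.
move=> Xp Xq neq_pq /eqP/cards1P[t pqw].
have im x y : x \in [set p; q] -> act x w = Some y -> y = t.
  move=> pqx xwy; apply/set1P; rewrite -pqw.
  by apply/set_actP; exists x.
(* If dropping [x] loses no image, then [X . w] has at most [#|X| - 1] elements, being covered by
   the image of [X :\ x] under a total map. *)
have shrink x : x \in X ->
    set_act X w \subset set_act (X :\ x) w -> #|set_act X w| < #|X|.
  move=> Xx sub; rewrite [#|X|](cardsD1 x) Xx add1n ltnS.
  apply: leq_trans (subset_leq_card sub) _.
  (* The default [t] is harmless: only an inclusion is needed, so [f] matters only where [act] is
     defined. *)
  pose f y := odflt t (act y w).
  apply: leq_trans (leq_imset_card f (X :\ x)).
  apply: subset_leq_card; apply/subsetP => y /set_actP[z Sz zwy].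
  by apply/imsetP; exists z; rewrite // /f zwy.
have /set_actP[x /set2P pq_x xwt]: t \in set_act [set p; q] w.
  by rewrite pqw set11.
(* [x] is a vertex of the pair that reaches [t]; the other one, [y], is the vertex to drop. *)
have [y [Xy pqy neq_xy Xx]] :
    exists y, [/\ y \in X, y \in [set p; q], x != y & x \in X].
  by case: pq_x => ->; [exists q | exists p];
     rewrite ?set21 ?set22 // eq_sym.
apply: (shrink y) => //; apply/subsetP => z /set_actP[y' Xy' y'wz].
apply/set_actP; have [eq_y|neq_y] := eqVneq y' y; last first.
  by exists y'; rewrite // !inE neq_y.
(* The image of [y], being defined here, is [t], which [x] already supplies. *)
exists x; first by rewrite !inE neq_xy.
by rewrite xwt -(im y z) // -eq_y.
Qed.

(** Induction on a strict bound for [#|X|]: a merge lowers it, and returned states have no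
    successor. *)
Lemma terminates_procedure : terminates G.
Proof.
have acc_ret r : Acc (fun s' s => step s s') (Returned G r).
  by constructor => s' st; inversion st.
suff acc_run n X u : #|X| < n -> Acc (fun s' s => step s s') (Running X u).
  exact: acc_run (ltnSn _).
elim: n X u => [X u|n IHn X u]; first by rewrite ltn0.
rewrite ltnS => leXn; constructor => s' st.
inversion st as [X' u' p q w _ Xp Xq neq_pq pqw| |]; subst; try exact: acc_ret.
apply: IHn; apply: leq_trans leXn.
exact: card_set_act_pair_synchronizing pqw.
Qed.

(** Excluded middle on the existence of a pair-synchronizing word makes one of [StepMerge] and
    [StepFail] apply to any chosen pair. *)
Lemma never_stuck_procedure : never_stuck G.
Proof.
move=> [X u|r] _; last by left; exists r.
right; have [ltX2|leX] := boolP (2 <= #|X|); last first.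
  by exists (Returned G (Some u)); apply: StepExit.
have /card_gt1P[p [q [Xp Xq neq_pq]]] := ltX2.
have [[w pqw]|no_w] := classic (exists w, pair_synchronizing p q w).
  by exists (Running (set_act X w) (u ++ w)); apply: StepMerge pqw.
exists (Returned G None); apply: (@StepFail _ _ X u p q) => // w pqw.
by apply: no_w; exists w.
Qed.

Hypothesis G_det : deterministic G.

Lemma act_cat q u w : act q (u ++ w) = obind (fun t => act t w) (act q u).
Proof.
case quwE: (act q (u ++ w)) => [t|].
  have /(actP _ _ _ G_det)[es [pes les <-]] := quwE.
  (* Cutting the path labeled [u ++ w] after [size u] edges gives paths labeled [u] and [w]. *)
  have eq_es := cat_take_drop (size u) es.
  have size_es : size u <= size es.
    by rewrite -(size_map (@label _ G) es) -/(path_label _) les size_cat leq_addr.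
  rewrite -{}eq_es path_from_cat /path_label map_cat in pes les *.
  have /andP[pes1 pes2] := pes.
  have sz : size (map (@label _ G) (take (size u) es)) = size u.
    by rewrite size_map size_takel.
  move/eqP: les; rewrite eqseq_cat // => /andP[/eqP les1 /eqP les2].
  rewrite path_end_cat.
  have -> : act q u = Some (path_end q (take (size u) es)).
    by apply/actP => //; exists (take (size u) es).
  by symmetry; apply/actP => //; exists (drop (size u) es).
(* Were both halves defined, their concatenation would be a path labeled [u ++ w]. *)
case quE: (act q u) => [t|] //=; case twE: (act t w) => [s|] //.
have /(actP _ _ _ G_det)[es [pes les eq_t]] := quE.
have /(actP _ _ _ G_det)[es' [pes' les' eq_s]] := twE.
rewrite -quwE; apply/actP => //; exists (es ++ es').
by rewrite path_from_cat pes path_end_cat eq_t pes' eq_s /path_label map_cat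
           -/(path_label es) les -/(path_label es') les'.
Qed.

Lemma act_nil q : act q [::] = Some q.
Proof. by apply/actP => //; exists [::]. Qed.

Lemma set_act_nil S : set_act S [::] = S.
Proof.
apply/setP => t; apply/set_actP/idP => [[q Sq]|St]; last first.
  by exists t => //; apply: act_nil.
by rewrite act_nil => -[<-].
Qed.

Lemma set_act_cat S u w : set_act S (u ++ w) = set_act (set_act S u) w.
Proof.
apply/setP => t; apply/set_actP/set_actP => [[q Sq]|[s /set_actP[q Sq qus] swt]].
  rewrite act_cat; case qus: (act q u) => [s|] //= swt.
  by exists s => //; apply/set_actP; exists q.
by exists q => //; rewrite act_cat qus.
Qed.

(** Nonemptiness of [X] is carried along because it turns the exit test [#|X| <= 1] into
    [#|X| = 1]. *)
Lemma reachable_invariant (s : state G) :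
  0 < #|vertex G| -> reachable s ->
  match s with
  | Running X u => X = set_act setT u /\ X != set0
  | Returned (Some u) => synchronizing G u
  | Returned None => exists p q, forall w, ~ pair_synchronizing p q w
  end.
Proof.
move=> G_gt0 /(clos_rt_rtn1 _ _ _ _); elim=> [|s' s'' st _].
  by rewrite /= set_act_nil -card_gt0 cardsT.
case: st => {s s' s''}
  [X u p q w _ Xp Xq _ pqw|X u p q _ _ _ _ no_w|X u]; first 2 last.
- rewrite -leqNgt => leX1 [defX X_neq0].
  by rewrite /synchronizing -defX; apply/eqP; rewrite eqn_leq leX1 card_gt0.
- move=> [defX _]; split; first by rewrite set_act_cat -defX.
  have sub_pq : [set p; q] \subset X by rewrite subUset !sub1set Xp.
  (* [X . w] contains the one-element set [{p, q} . w], hence is nonempty. *)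
  by rewrite -card_gt0 -[0.+1]pqw; apply/subset_leq_card/set_actS.
- by move=> _; exists p, q.
Qed.

Lemma pair_synchronizing_exists p q :
  irreducible G -> (exists w, synchronizing G w) ->
  exists w, pair_synchronizing p q w.
Proof.
move=> G_irr [w syn_w].
have /set0Pn[t /set_actP[q0 _ q0wt]] : set_act [set: vertex G] w != set0.
  by rewrite -card_gt0 syn_w.
have [es pes ees] := G_irr p q0.
exists (path_label es ++ w); apply/eqP; rewrite eqn_leq; apply/andP; split.
  rewrite -[leqRHS]syn_w set_act_cat; apply: subset_leq_card.
  exact/set_actS/subsetT.
rewrite card_gt0; apply/set0Pn; exists t; apply/set_actP.
exists p; rewrite ?set21 // act_cat.
have -> : act p (path_label es) = Some q0 by apply/actP => //; exists es.
by [].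
Qed.

End Action.

Theorem theorem3p1 (A : finType) (G : labeled_graph A)
    (G_nonempty : 0 < #|vertex G|)
    (G_det : deterministic G) (G_irr : irreducible G) :
  ((exists w, synchronizing G w) ->
     procedure_returns G (fun r =>
       exists u, r = Some u /\ synchronizing G u)) /\
  (~ (exists w, synchronizing G w) ->
     procedure_returns G (fun r => r = None)).
Proof.
have term := @terminates_procedure A G; have live := @never_stuck_procedure A G.
split=> syn; split=> // -[u|] // /(reachable_invariant G_det G_nonempty).
- by exists u.
- move=> [p [q no_w]].
  (* A nil outcome would exhibit a pair that no word synchronizes. *)
  by have [w /no_w] := pair_synchronizing_exists G_det p q G_irr syn.
- by move=> syn_u; case: syn; exists u.
Qed.
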